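(* Let $(W,S)$ be a Coxeter system whose nerve $L$ is a graph with no $3$-cycles, all of whose edges carry the same label $m$ (i.e. $m_{st}=m$ whenever $\{s,t\}$ is an edge of $L$). If $m$ is a multiple of $\operatorname{lcm}_{s\in S}\deg(s)$, where $\deg(s)$ is the degree of the vertex $s$ in $L$, then $L^2_\mathbf{q}H_2(\Sigma(W,S))=0$ for every multiparameter $\mathbf{q}\le\mathbf{1}$.
   Context: The nerve $L$ of $(W,S)$ is the simplicial complex with vertex set $S$ whose simplices are the nonempty spherical subsets (those generating finite subgroups); here it is one-dimensional, edges $\{s,t\}$ labeled by $m_{st}$, and non-adjacent $s,t$ have $m_{st}=\infty$. A multiparameter is $\mathbf{q}=(q_s)_{s\in S}$, $q_s>0$, constant on conjugacy classes; $\mathbf{q}\le\mathbf{1}$ means $q_s\le1$ for all $s$. Weighted $L^2$-homology of the Davis complex $\Sigma(W,S)$: cell $w\sigma$ gets measure $q_u$, $u$ the shortest element of $wW_{S(\sigma)}$; chains square-summable for $\sum f(\sigma)g(\sigma)\mu_\mathbf{q}(\sigma)$; boundary $\partial^\mathbf{q}$ the adjoint of the coboundary; $L^2_\mathbf{q}H_i=\ker\partial^\mathbf{q}_i/\overline{\operatorname{im}\partial^\mathbf{q}_{i+1}}$. *)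

(* Defs.v *)
From Stdlib Require Import Reals ClassicalEpsilon.
From HB Require Import structures.
From mathcomp Require Import all_boot.
Set Implicit Arguments. Unset Strict Implicit. Unset Printing Implicit Defensive.
Local Open Scope group_scope.

Section Coxeter.
Variables (S : finType) (W : groupType) (gen : S -> W).

Definition evalw (w : seq S) : W := foldr (fun s x => gen s * x) 1 w.

(* Coxeter relations for the Coxeter matrix determined by the graph adj with
   all edge labels m: m_ss = 1, m_st = m on edges, m_st = oo off edges. *)
Definition cox_rel (H : groupType) (f : S -> H) (adj : rel S) (m : nat) :=
  (forall s, f s * f s = 1) /\ (forall s t, adj s t -> (f s * f t) ^+ m = 1).

Definition is_coxeter (adj : rel S) (m : nat) : Prop :=
  (forall x : W, exists w, evalw w = x) /\ cox_rel gen adj m /\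
  forall (H : groupType) (f : S -> H), cox_rel f adj m ->
    exists phi : W -> H, phi 1 = 1 /\ (forall x y, phi (x * y) = phi x * phi y)
                         /\ forall s, phi (gen s) = f s.

Definition len (u : W) : nat :=
  epsilon (inhabits 0%N) (fun n =>
    (exists w, size w = n /\ evalw w = u) /\
    forall w, evalw w = u -> (n <= size w)%N).

Definition prodR (l : seq R) : R := foldr Rmult R1 l.

Definition qW (q : S -> R) (u : W) : R :=
  epsilon (inhabits R1) (fun x =>
    exists w, evalw w = u /\ size w = len u /\ x = prodR (map q w)).

Definition inWT (T : pred S) (x : W) : Prop :=
  exists w : seq S, all T w /\ evalw w = x.

Definition min_in_coset (T : pred S) (u : W) : Prop :=
  forall x, inWT T x -> (len u <= len (u * x))%N.

Definition cmin (T : pred S) (w : W) : W :=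
  epsilon (inhabits w) (fun u =>
    (exists x, inWT T x /\ u = w * x) /\
    forall y, inWT T y -> (len u <= len (w * y))%N).

Variables (adj : rel S) (m : nat) (q : S -> R).

(* Cells of the Davis complex Sigma(W,S) of dimension 1 and 2.
   1-cell  (v, r)    = coset v W_{r}, v its shortest element,
                       oriented from v to v r.
   2-cell  (u, s, t) = coset u W_{s,t}, {s,t} an edge of L, u shortest,
                       s before t in the enumeration of S (fixes the
                       orientation: boundary walk u, us, ust, ...). *)
Definition is_cell1 (v : W) (r : S) : Prop := min_in_coset (pred1 r) v.
Definition is_cell2 (u : W) (s t : S) : Prop :=
  adj s t /\ (enum_rank s < enum_rank t)%N /\ min_in_coset (pred2 s t) u.

Definition letter (s t : S) (i : nat) : S := if odd i then t else s.
Fixpoint alt (s t : S) (i : nat) : W :=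
  if i is i'.+1 then alt s t i' * gen (letter s t i') else 1.

(* incidence number [sigma : tau] of the 2-cell (u,s,t) on the 1-cell (v,r):
   the boundary 2m-gon is u, us, ust, ..., u(st)^m = u. *)
Definition inc2 (u : W) (s t : S) (v : W) (r : S) : R :=
  \big[Rplus/R0]_(i < 2 * m)
    (if letter s t i == r then
       Rminus (if u * alt s t i == v then R1 else R0)
              (if u * alt s t i == v * gen r then R1 else R0)
     else R0).

Definition chain2 := W -> S -> S -> R.

Definition sq_summable2 (g : chain2) : Prop :=
  exists B : R, forall l : seq (W * S * S), uniq l ->
    (forall c, c \in l -> is_cell2 c.1.1 c.1.2 c.2) ->
    Rle (\big[Rplus/R0]_(c <- l) (Rmult (Rmult (g c.1.1 c.1.2 c.2) (g c.1.1 c.1.2 c.2)) (qW q c.1.1))) B.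

(* the weighted boundary d^q_2 = adjoint of the coboundary delta^1 w.r.t. the
   mu_q-weighted inner products, evaluated at the 1-cell (v,r):
   (d g)(tau) = mu(tau)^-1 * sum_{sigma > tau} [sigma:tau] mu(sigma) g(sigma).
   The 2-cells containing v W_r are the cosets v W_{r,t}, t adjacent to r. *)
Definition bd2 (g : chain2) (v : W) (r : S) : R :=
  Rmult (/ qW q v)
   (\big[Rplus/R0]_(t : S | adj r t)
     (let s1 := if (enum_rank r < enum_rank t)%N then r else t in
      let t1 := if (enum_rank r < enum_rank t)%N then t else r in
      let u := cmin (pred2 r t) v in
      Rmult (Rmult (inc2 u s1 t1 v r) (qW q u)) (g u s1 t1))).

(* L^2_q H_2(Sigma) = ker d_2 (there are no 3-cells) vanishes *)
Definition L2H2_vanishes : Prop :=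
  forall g : chain2, sq_summable2 g ->
    (forall v r, is_cell1 v r -> bd2 g v r = R0) ->
    forall u s t, is_cell2 u s t -> g u s t = R0.

End Coxeter.

(* Main.v *)
Require Import Defs.
From Stdlib Require Import Reals ClassicalEpsilon Lra.
From HB Require Import structures.
From mathcomp Require Import all_boot fingroup perm ssralg zmodp boolp.
From mathcomp Require Import zify.

(** Put [h = q_u g]. If [g] is a weighted cycle then [h] is an ordinary cycle, and
    [q <= 1] makes it square-summable. Every edge [(v, r)] of a cell [u W_{a,b}]
    off its shortest vertex [u] has a descent of [v] adjacent to [r]; since two
    distinct descents of an element are adjacent and [L] has no 3-cycles, every
    other cell around that edge has [v] as its shortest vertex. Thus the cells,
    each taken once for each of its two edges at [u], form a forest in which
    lengths increase: the children of [(u, a, b)] are the other cells around the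
    [m - 1] edges at [u a], [u a b], ... on the side of [a]. The cycle condition
    at such an edge writes [h(u)] up to sign as the sum of at most
    [deg - 1 <= m - 1] children, so by Cauchy-Schwarz [h(u)^2] is at most the sum
    of [h^2] over all children. Hence each generation below a cell carries at
    least its energy, and square-summability forces [h = 0].

    The facts on lengths come from the inversion cocycle, obtained from the
    universal property of [W] with values in [W] extended by subsets of [W]. *)

Set Implicit Arguments. Unset Strict Implicit. Unset Printing Implicit Defensive.
Local Open Scope group_scope.
Delimit Scope R_scope with Re.

(** * Words and involutions in groups *)

Lemma evalw_cat (S : finType) (W : groupType) (gen : S -> W) w1 w2 :
  evalw gen (w1 ++ w2) = evalw gen w1 * evalw gen w2.
Proof. by elim: w1 => [|s w IH] /=; rewrite ?mul1g // IH mulgA. Qed.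

Lemma evalw_rcons (S : finType) (W : groupType) (gen : S -> W) w s :
  evalw gen (rcons w s) = evalw gen w * gen s.
Proof. by rewrite -cats1 evalw_cat /= mulg1. Qed.

Lemma involution_inv (G : groupType) (x : G) : x * x = 1 -> x^-1 = x.
Proof. by move=> xx; rewrite -[LHS]mulg1 -xx mulgA mulVg mul1g. Qed.

Lemma mul_involutionsC_expg (G : groupType) (x y : G) k :
  x * x = 1 -> y * y = 1 -> (x * y) ^+ k = 1 -> (y * x) ^+ k = 1.
Proof.
move=> xx yy xyk; have -> : y * x = (x * y)^-1.
  by rewrite invgM !involution_inv.
by rewrite expVgn xyk invg1.
Qed.

Lemma conj_eq (G : groupType) (x y p : G) :
  (y * p * y^-1 == x) = (p == y^-1 * x * y).
Proof.
by apply/eqP/eqP => [<-|->]; rewrite !mulgA ?mulVg ?mulgV mul1g ?mulgKV ?mulgK.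
Qed.

(** * The group of subsets of [W] twisted by conjugation *)

Section Inversions.
Variable W : groupType.

(* [W] semidirect the group of subsets of [W] under symmetric difference, on
   which [W] acts by conjugation. *)
Definition twisted_subset : Type := (W * (W -> bool))%type.
Implicit Types x y z : twisted_subset.

HB.instance Definition _ := Choice.copy twisted_subset (W * (W -> bool))%type.

Definition tws_mul x y : twisted_subset :=
  (x.1 * y.1, fun p => x.2 (y.1 * p * y.1^-1) (+) y.2 p).
Definition tws_one : twisted_subset := (1, fun=> false).
Definition tws_inv x : twisted_subset := (x.1^-1, fun p => x.2 (x.1^-1 * p * x.1)).

Lemma tws_mulA : associative tws_mul.
Proof.
move=> [x A] [y B] [z C]; rewrite /tws_mul /=; congr (_, _); first exact: mulgA.
by apply: funext => p; rewrite addbA invgM !mulgA.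
Qed.

Lemma tws_mul1 : left_id tws_one tws_mul.
Proof.
by move=> [x A]; rewrite /tws_mul /= mul1g; congr (_, _); apply: funext.
Qed.

Lemma tws_1mul : right_id tws_one tws_mul.
Proof.
move=> [x A]; rewrite /tws_mul /= mulg1; congr (_, _); apply: funext => p.
by rewrite mul1g invg1 mulg1 addbF.
Qed.

Lemma tws_mulV : left_inverse tws_one tws_inv tws_mul.
Proof.
move=> [x A]; rewrite /tws_mul /= mulVg; congr (_, _); apply: funext => p.
by rewrite !mulgA mulVg mul1g mulgKV addbb.
Qed.

Lemma tws_Vmul : right_inverse tws_one tws_inv tws_mul.
Proof.
move=> [x A]; rewrite /tws_mul /= mulgV; congr (_, _); apply: funext => p.
by rewrite invgK addbb.
Qed.

HB.instance Definition _ := isGroup.Build twisted_subset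
  tws_mulA tws_mul1 tws_1mul tws_mulV tws_Vmul.

End Inversions.

(* Permutations of ['Z_m * 'Z_N]: [c] and [a] reflect the first coordinate, [n]
   rotates the fibre over [0], and [b] is the conjugate of [a] by [n]. Since [n]
   commutes with [c], [b * c] is conjugate to [a * c]. *)
Lemma involution_triple (m N : nat) : (1 < m)%N -> (1 < N)%N ->
  exists (G : groupType) (a b c : G),
    [/\ a * a = 1, b * b = 1 & c * c = 1] /\
    [/\ (a * c) ^+ m = 1, (b * c) ^+ m = 1,
        forall k, (a * c) ^+ k = 1 -> (m %| k)%N &
        forall k, (a * b) ^+ k = 1 -> (N %| k)%N].
Proof.
move=> m1 N1; pose Y := ('Z_m * 'Z_N)%type.
pose fa (y : Y) : Y := ((1 - y.1)%R, y.2).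
pose fc (y : Y) : Y := ((- y.1)%R, y.2).
pose fn (y : Y) : Y := (y.1, (y.2 + (y.1 == 0)%R%:R)%R).
have fa_inj : injective fa.
  by apply: (can_inj (g := fa)) => -[x y]; rewrite /fa /= GRing.subKr.
have fc_inj : injective fc.
  by apply: (can_inj (g := fc)) => -[x y]; rewrite /fc /= GRing.opprK.
have fn_inj : injective fn.
  apply: (can_inj (g := fun y : Y => (y.1, (y.2 - (y.1 == 0)%R%:R)%R))) => -[x y].
  by rewrite /fn /= GRing.addrK.
pose a := perm fa_inj; pose c := perm fc_inj; pose n := perm fn_inj.
have aa : a * a = 1.
  by apply/permP => -[x y]; rewrite permM !permE /fa /= GRing.subKr.
have cc : c * c = 1.
  by apply/permP => -[x y]; rewrite permM !permE /fc /= GRing.opprK.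
have nc : c ^ n = c.
  apply/conjg_fixP/commgP/permP => -[x y].
  by rewrite !permM !permE /fn /fc /= GRing.oppr_eq0.
(* Products of permutations act from left to right, so [a * c] sends [x] to [1 - x] and then to
   [x - 1]. *)
have ack k x y : ((a * c) ^+ k) (x, y) = ((x - k%:R)%R, y).
  elim: k x y => [|k IH] x y; first by rewrite expg0 perm1 GRing.subr0.
  rewrite expgS permM permM !permE /= IH /=; congr (_, _).
  by rewrite GRing.opprB -GRing.addrA -GRing.opprD -GRing.mulrS.
have acm : (a * c) ^+ m = 1.
  apply/permP => -[x y]; rewrite ack perm1; congr (_, _).
  by rewrite pchar_Zp // GRing.subr0.
exists {perm Y}, a, (a ^ n), c; split.
  by split; rewrite -?conjMg ?aa ?cc ?conj1g.
split => //.
- by rewrite -{1}nc -conjMg -conjXg acm conj1g.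
- move=> k ack1; have := ack k 0%R 0%R; rewrite ack1 perm1 => /(congr1 fst)/esym/eqP /=.
  by rewrite GRing.sub0r GRing.oppr_eq0 => /eqP/(congr1 val) /=; rewrite val_Zp_nat // => /eqP.
move=> k abk1.
(* On the fibre over 0, [a] moves to the fibre over 1, which [n] fixes pointwise; the conjugate
   [a ^ n] then returns and rotates by one. *)
have abk j y : ((a * a ^ n) ^+ j) (0%R, y) = (0%R, (y + j%:R)%R).
  elim: j y => [|j IH] y; first by rewrite expg0 perm1 GRing.addr0.
  have nE : n (1%R, y) = (1%R, y) by rewrite permE /fn /= GRing.addr0.
  have aE x z : a (x, z) = ((1 - x)%R, z) by rewrite permE.
  rewrite expgS permM permM /conjg !permM aE GRing.subr0 -{1}nE permK aE.
  rewrite GRing.subrr [n _]permE /fn /= IH; congr (_, _).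
  by rewrite -GRing.addrA -GRing.mulrS.
have := abk k 0%R; rewrite abk1 perm1 GRing.add0r => /(congr1 snd)/esym/(congr1 val).
by rewrite /= val_Zp_nat // => /eqP.
Qed.

(** * Finite sums of real numbers *)

HB.instance Definition _ := Monoid.isComLaw.Build R R0 Rplus
  (fun x y z => esym (Rplus_assoc x y z)) Rplus_comm Rplus_0_l.

Lemma sumR_ge0 (I : Type) (l : seq I) (F : I -> R) :
  (forall i, (0 <= F i)%Re) -> (0 <= \big[Rplus/R0]_(i <- l) F i)%Re.
Proof.
by move=> F0; elim/big_rec: _ => [|i x _ x0]; [lra|have := F0 i; lra].
Qed.

Lemma sumR_le (I : eqType) (l : seq I) (F G : I -> R) :
  (forall i, i \in l -> (F i <= G i)%Re) ->
  (\big[Rplus/R0]_(i <- l) F i <= \big[Rplus/R0]_(i <- l) G i)%Re.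
Proof.
move=> FG; rewrite big_seq [X in (_ <= X)%Re]big_seq.
by elim/big_rec2: _ => [|i x y /FG]; lra.
Qed.

Lemma sumR_const (I : Type) (l : seq I) (c : R) :
  \big[Rplus/R0]_(i <- l) c = (INR (size l) * c)%Re.
Proof.
elim: l => [|i l IH]; first by rewrite big_nil /=; lra.
rewrite big_cons IH -[size (_ :: _)]/((size _).+1) S_INR; lra.
Qed.

Lemma sumR_distrr (I : Type) (l : seq I) (c : R) (F : I -> R) :
  (c * \big[Rplus/R0]_(i <- l) F i)%Re = \big[Rplus/R0]_(i <- l) (c * F i)%Re.
Proof.
elim: l => [|i l IH]; first by rewrite !big_nil; lra.
by rewrite !big_cons -IH; lra.
Qed.

Lemma sumR_sqr_le (I : Type) (l : seq I) (F : I -> R) :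
  (Rsqr (\big[Rplus/R0]_(i <- l) F i) <=
   INR (size l) * \big[Rplus/R0]_(i <- l) Rsqr (F i))%Re.
Proof.
elim: l => [|i l IH]; first by rewrite !big_nil /Rsqr /=; lra.
rewrite !big_cons -[size (_ :: _)]/((size _).+1) S_INR.
set X := \big[Rplus/R0]_(j <- l) F j in IH *.
set Q := \big[Rplus/R0]_(j <- l) Rsqr (F j) in IH *.
set n := INR (size l) in IH *.
(* This is the sum over [j] of the inequalities [(F i - F j)^2 >= 0]. *)
have cross : (2 * F i * X <= n * Rsqr (F i) + Q)%Re.
  rewrite /X /Q /n; elim: (l) => [|j r IHr]; first by rewrite !big_nil /=; lra.
  rewrite !big_cons -[size (_ :: _)]/((size _).+1) S_INR.
  have := Rle_0_sqr (F i - F j); move: IHr; rewrite /Rsqr; lra.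
move: IH cross; rewrite /Rsqr; lra.
Qed.

(** * Orders of products of generators, parity, and the inversion cocycle *)

Section CoxeterGroup.
Variables (S : finType) (adj : rel S) (m : nat) (W : groupType) (gen : S -> W).
Hypotheses (adj_irr : forall s, ~~ adj s s)
  (adj_sym : forall s t, adj s t = adj t s) (m_gt1 : (2 <= m)%N)
  (cox : is_coxeter gen adj m).

Lemma gen_sq s : gen s * gen s = 1.
Proof. by case: cox => _ [[]]. Qed.

Lemma gen_inv s : (gen s)^-1 = gen s.
Proof. exact/involution_inv/gen_sq. Qed.

Lemma gen_mulK x s : x * gen s * gen s = x.
Proof. by rewrite -mulgA gen_sq mulg1. Qed.

Lemma gen_braid s t : adj s t -> (gen s * gen t) ^+ m = 1.
Proof. by case: cox => _ [[_]] H _; exact: H. Qed.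

(* The [k]-th power of [(gen s * gen t, inversions of gen s * gen t)] carries the
   reflections [gen t * (gen s * gen t) ^+ j], [j < 2 * k]; for [k = m] each
   appears twice, so they cancel. *)
Lemma inversions_cox_rel :
  cox_rel (fun s => (gen s, fun p => p == gen s) : twisted_subset W) adj m.
Proof.
split=> [s|s t st].
  congr (_, _); first exact: gen_sq.
  by apply: funext => p /=; rewrite conj_eq gen_inv gen_sq mul1g addbb.
set c := gen s * gen t.
have cV : c^-1 = gen t * gen s by rewrite invgM !gen_inv.
have ctk k : (c ^+ k)^-1 * gen t = gen t * c ^+ k.
  elim: k => [|k IH]; first by rewrite !expg0 invg1 mul1g mulg1.
  by rewrite {1}expgSr invgM -mulgA IH expgS !mulgA cV.
set z : twisted_subset W := (X in X ^+ m).
have zk k : z ^+ k = (c ^+ k,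
    fun p => \big[addb/false]_(j < 2 * k) (p == gen t * c ^+ j)) :> twisted_subset W.
  elim: k => [|k IH].
    by rewrite muln0 !expg0; congr (_, _); apply: funext => p; rewrite big_ord0.
  rewrite expgS IH; congr (_, _); first by rewrite /= -expgS.
  apply: funext => p /=.
  rewrite mulnS addnC !addnS addn0 !big_ord_recr /= addbC -addbA; congr (_ (+) _).
  rewrite !conj_eq gen_inv !mulgA ctk addbC mul2n -addnn; congr (_ (+) _).
    by rewrite -mulgA -expgnDr.
  by rewrite -addnS expgnDr expgS -!mulgA.
rewrite zk gen_braid //; congr (_, _); apply: funext => p.
rewrite mul2n -addnn big_split_ord /=.
rewrite [X in _ (+) X](eq_bigr (fun j : 'I_m => p == gen t * c ^+ j)) ?addbb //.
by move=> j _; rewrite expgnDr gen_braid // mul1g.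
Qed.


(** Relations are detected in the group of [involution_triple] with [N = k + 1]. For non-adjacent
    [s], [t], send [s] to [a], [t] to [b] and all other generators to [c]: no edge is sent to the
    pair [a], [b], so the Coxeter relations hold, while [k + 1] cannot divide [k]. For adjacent [s],
    [t], send [s] to [a] and everything else to [c]; then [a * c] has order exactly [m]. *)
Lemma gen_mul_order s t k : s != t -> (0 < k)%N ->
  (gen s * gen t) ^+ k = 1 -> adj s t /\ (m %| k)%N.
Proof.
move=> st k0 stk; case: cox => _ [_ univ].
have [G [a [b [c [[aa bb cc] [acm bcm ack abk]]]]]] :=
  involution_triple m_gt1 (k0 : (1 < k.+1)%N).
have [cam cbm] : (c * a) ^+ m = 1 /\ (c * b) ^+ m = 1.
  by split; apply: mul_involutionsC_expg.
case st_adj : (adj s t); last first.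
  pose f x := if x == s then a else if x == t then b else c.
  have [|phi [phi1 [phiM phig]]] := univ G f.
    rewrite /f; split=> [x|x y]; first by case: ifP => // _; case: ifP.
    case: (x =P s) => [->|_]; case: (y =P s) => [->|_]; rewrite ?aa ?expg1n //;
      try case: (x =P t) => [->|_]; try case: (y =P t) => [->|_];
      by rewrite ?bb ?cc ?expg1n ?[adj t s]adj_sym ?st_adj.
  have phiX x j : phi (x ^+ j) = phi x ^+ j.
    by elim: j => [|j IH]; rewrite ?expg0 // !expgS phiM IH.
  have := congr1 phi stk; rewrite phiX phiM !phig phi1 /f eqxx eqxx.
  rewrite eq_sym (negPf st) => /abk /dvdn_leq; rewrite k0 => /(_ isT).
  by rewrite ltnn.
split=> //; pose f x := if x == s then a else c.
have [|phi [phi1 [phiM phig]]] := univ G f.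
  rewrite /f; split=> [x|x y _]; first by case: eqP.
  by do 2!case: ifP => _; rewrite ?aa ?cc ?expg1n.
have phiX x j : phi (x ^+ j) = phi x ^+ j.
  by elim: j => [|j IH]; rewrite ?expg0 // !expgS phiM IH.
apply: ack; have := congr1 phi stk; rewrite phiX phiM !phig phi1 /f eqxx.
by rewrite eq_sym (negPf st).
Qed.

(** Sending every generator to the transposition of [bool] respects the Coxeter relations, and its
    sign is word length modulo 2. *)
Lemma sign_morphism : exists sg : W -> bool,
  {morph sg : x y / x * y >-> x (+) y} /\ forall s, sg (gen s).
Proof.
case: cox => _ [_ univ]; pose tau := tperm true false.
have [|phi [_ [phiM phig]]] := univ {perm bool} (fun=> tau).
  by split=> [_|_ _ _]; rewrite tperm2 ?expg1n.
exists (fun x => odd_perm (phi x)); split=> [x y|s] /=; first by rewrite phiM odd_permM.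
by rewrite phig odd_tperm.
Qed.

Lemma sign_alt (sg : W -> bool) s t i : {morph sg : x y / x * y >-> x (+) y} ->
  (forall r, sg (gen r)) -> sg (alt gen s t i) = odd i.
Proof.
move=> sgM sgg; elim: i => [|i IH] /=; last by rewrite sgM IH sgg addbT.
by have := sgM 1 1; rewrite mulg1; case: (sg 1).
Qed.

Lemma alt_parity s t s' t' i j :
  alt gen s t i = alt gen s' t' j -> odd i = odd j.
Proof.
have [sg [sgM sgg]] := sign_morphism.
by move=> /(congr1 sg); rewrite !sign_alt.
Qed.

(** The universal property gives a morphism to twisted subsets. Its first component is the identity,
    as it is so on generators; its second component is the cocycle. *)
Lemma inversion_cocycle : exists I : W -> W -> bool,
  (forall s p, I (gen s) p = (p == gen s)) /\
  (forall x y p, I (x * y) p = I x (y * p * y^-1) (+) I y p).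
Proof.
case: cox => surj [_ univ].
have [phi [phi1 [phiM phig]]] := univ _ _ inversions_cox_rel.
have fst_phi x : (phi x).1 = x.
  have [w <-] := surj x; elim: w => [|s w IH] /=; first by rewrite phi1.
  by rewrite phiM /= IH phig.
exists (fun x => (phi x).2); split=> [s p|x y p]; first by rewrite phig.
by rewrite phiM /= fst_phi.
Qed.

(** * Inversions and word length *)

Definition inversion : W -> W -> bool := projT1 (cid inversion_cocycle).

Lemma inversion_gen s p : inversion (gen s) p = (p == gen s).
Proof. by case: (projT2 (cid inversion_cocycle)). Qed.

Lemma inversionM x y p :
  inversion (x * y) p = inversion x (y * p * y^-1) (+) inversion y p.
Proof. by case: (projT2 (cid inversion_cocycle)). Qed.

Lemma inversion1 p : inversion 1 p = false.
Proof.
have := inversionM 1 1 p; rewrite mulg1 mul1g invg1 mulg1.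
by case: (inversion 1 p).
Qed.

(** By the cocycle rule for [s :: w], either [p] is the first letter conjugated by the tail, and
    multiplying by [p] deletes that letter, or [p] is an inversion of the tail and induction
    applies. Only deletions occur, so the letters stay in [T]. *)
Lemma strong_exchange (T : pred S) w p : all T w -> inversion (evalw gen w) p ->
  exists w', [/\ all T w', (size w' < size w)%N & evalw gen w' = evalw gen w * p].
Proof.
elim: w p => [|s w IH] p /=; first by rewrite inversion1.
case/andP=> Ts Tw; rewrite inversionM inversion_gen conj_eq.
case: eqP => [-> _|_ /= /(IH _ Tw)[w' [Tw' szw' ev]]].
  by exists w; rewrite !mulgA mulgK gen_sq mul1g.
by exists (s :: w'); split; rewrite /= ?Ts // ev mulgA.
Qed.

Lemma len_spec u : (exists w, size w = len gen u /\ evalw gen w = u) /\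
  (forall w, evalw gen w = u -> (len gen u <= size w)%N).
Proof.
have [w0 w0u] := cox.1 u.
pose P n := `[< exists w, size w = n /\ evalw gen w = u >].
have exP : exists n, P n by exists (size w0); apply/asboolP; exists w0.
apply: (epsilon_spec (inhabits 0%N) (fun n =>
  (exists w, size w = n /\ evalw gen w = u) /\
  (forall w, evalw gen w = u -> (n <= size w)%N))).
case: (ex_minnP exP) => n /asboolP Pn minn; exists n; split=> // w wu.
by apply: minn; apply/asboolP; exists w.
Qed.

Lemma len_inversion w p : inversion w p -> (len gen (w * p) < len gen w)%N.
Proof.
have [[x [<- <-]] _] := len_spec w.
move=> /(strong_exchange (all_predT x))[y [_ lty <-]].
by apply: leq_ltn_trans lty; apply: (len_spec _).2.
Qed.

Lemma len_not_inversion w s :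
  ~~ inversion w (gen s) -> (len gen w < len gen (w * gen s))%N.
Proof.
move=> nws; rewrite -{1}[w](gen_mulK _ s); apply: len_inversion.
by rewrite inversionM mulgK inversion_gen eqxx (negPf nws).
Qed.

(** * Minimal coset representatives *)

Lemma inWT1 (T : pred S) : inWT gen T 1.
Proof. by exists [::]. Qed.

Lemma inWT_gen (T : pred S) s : T s -> inWT gen T (gen s).
Proof. by move=> Ts; exists [:: s]; rewrite /= Ts mulg1. Qed.

Lemma inWTM (T : pred S) x y : inWT gen T x -> inWT gen T y -> inWT gen T (x * y).
Proof.
move=> [w [Tw <-]] [v [Tv <-]]; exists (w ++ v).
by rewrite all_cat Tw Tv evalw_cat.
Qed.

Lemma inWTV (T : pred S) x : inWT gen T x -> inWT gen T x^-1.
Proof.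
move=> [w [Tw <-]]; exists (rev w); rewrite all_rev Tw; split=> //.
elim: w {Tw} => [|s w IH] /=; first by rewrite invg1.
by rewrite rev_cons evalw_rcons IH invgM gen_inv.
Qed.

Lemma inWT_eq (T T' : pred S) x : T =1 T' -> inWT gen T x -> inWT gen T' x.
Proof. by move=> TT' [w [Tw <-]]; exists w; rewrite -(eq_all TT'). Qed.

Lemma min_in_coset_eq (T T' : pred S) u : T =1 T' ->
  min_in_coset gen T u -> min_in_coset gen T' u.
Proof. by move=> TT' umin x /(inWT_eq (fsym TT'))/umin. Qed.

Lemma min_in_coset_inversion (T : pred S) u p :
  min_in_coset gen T u -> inWT gen T p -> ~~ inversion u p.
Proof.
move=> umin /umin; rewrite leqNgt; apply: contra; exact: len_inversion.
Qed.

(** The conjugate of [p] by [x] stays in the subgroup of [T], where a shortest coset representative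
    has no inversion. *)
Lemma min_in_coset_inversionM (T : pred S) u x p : min_in_coset gen T u ->
  inWT gen T x -> inWT gen T p -> inversion (u * x) p = inversion x p.
Proof.
move=> umin Tx Tp; rewrite inversionM (negPf (min_in_coset_inversion umin _)) //.
by apply: inWTM; [apply: inWTM | apply: inWTV].
Qed.

(** The last letter of a shortest word for [x] with letters in [T] is a descent: otherwise it is an
    inversion of the prefix, and exchange yields a still shorter such word. *)
Lemma inWT_descent (T : pred S) x : inWT gen T x -> x <> 1 ->
  exists2 s, T s & inversion x (gen s).
Proof.
move=> Tx x1; pose P n := `[< exists w, [/\ all T w, size w = n & evalw gen w = x] >].
have exP : exists n, P n.
  by case: Tx => w [Tw wx]; exists (size w); apply/asboolP; exists w.
case: (ex_minnP exP) => n /asboolP[w [Tw szw wx]] minn.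
case/lastP: w Tw szw wx => [|w s] Tw szw wx; first by case: x1.
move: Tw; rewrite all_rcons => /andP[Ts Tw]; exists s => //.
apply: contraT => nxs; exfalso.
have : inversion (evalw gen w) (gen s).
  move: nxs; rewrite -wx evalw_rcons inversionM inversion_gen eqxx addbT.
  by rewrite mulgK negbK.
move=> /(strong_exchange Tw)[w' [Tw' ltw']]; rewrite -evalw_rcons wx => w'x.
have : P (size w') by apply/asboolP; exists w'.
by move/minn; rewrite -szw size_rcons; lia.
Qed.

Lemma cmin_spec (T : pred S) v : min_in_coset gen T (cmin gen T v) /\
  exists2 x, inWT gen T x & v = cmin gen T v * x.
Proof.
pose Q u := (exists x, inWT gen T x /\ u = v * x) /\
    forall y, inWT gen T y -> (len gen u <= len gen (v * y))%N.
have : Q (cmin gen T v).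
  apply: (epsilon_spec (inhabits v) Q).
  pose P n := `[< exists x, inWT gen T x /\ len gen (v * x) = n >].
  have exP : exists n, P n.
    by exists (len gen (v * 1)); apply/asboolP; exists 1; split=> //; exact: inWT1.
  case: (ex_minnP exP) => n /asboolP[x [Tx lenx]] minn.
  exists (v * x); split=> [|y Ty]; first by exists x.
  by rewrite lenx; apply: minn; apply/asboolP; exists y.
move=> [[x [Tx ->]] minx]; split; last by exists x^-1; [exact: inWTV|rewrite mulgK].
by move=> y Ty; rewrite -mulgA; apply: minx; apply: inWTM.
Qed.

Lemma min_in_coset_uniq (T : pred S) u x : min_in_coset gen T u ->
  inWT gen T x -> min_in_coset gen T (u * x) -> x = 1.
Proof.
move=> umin Tx uxmin; apply: contrapT => /(inWT_descent Tx)[s Ts].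
rewrite -(min_in_coset_inversionM umin) //; last exact: inWT_gen.
by apply/negP; apply: min_in_coset_inversion uxmin _; exact: inWT_gen.
Qed.

Lemma cmin_eq (T : pred S) u x :
  min_in_coset gen T u -> inWT gen T x -> cmin gen T (u * x) = u.
Proof.
move=> umin Tx; have [cm [y Ty e]] := cmin_spec T (u * x).
have Eu : cmin gen T (u * x) = u * (x * y^-1) by rewrite mulgA {2}e mulgK.
rewrite Eu in cm; rewrite Eu (min_in_coset_uniq umin _ cm) ?mulg1 //.
by apply: inWTM => //; exact: inWTV.
Qed.

(** Write [v] as shortest representative times [x]. If [x] is nontrivial it has a descent in [T],
    and this is also a descent of [v]. *)
Lemma min_in_coset_descents (T : pred S) v :
  (forall s, T s -> ~~ inversion v (gen s)) -> min_in_coset gen T v.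
Proof.
move=> nv; have [cm [x Tx e]] := cmin_spec T v.
have [x1|/eqP/(inWT_descent Tx)[s Ts]] := eqVneq x 1; first by rewrite e x1 mulg1.
rewrite -(min_in_coset_inversionM cm) //; last exact: inWT_gen.
by rewrite -e (negPf (nv s Ts)).
Qed.

(** * Dihedral subgroups *)

Lemma letterS (s t : S) i : letter s t i.+1 = letter t s i.
Proof. by rewrite /letter /=; case: odd. Qed.

Lemma letter_pair (s t : S) i : pred2 s t (letter s t i).
Proof. by rewrite /letter /=; case: odd; rewrite eqxx ?orbT. Qed.

Lemma letter_neq (s t : S) i : s != t -> letter s t i != letter t s i.
Proof. by rewrite /letter; case: odd => //; rewrite eq_sym. Qed.

Lemma letter_adj s t i : adj s t -> adj (letter s t i) (letter t s i).
Proof. by rewrite /letter; case: odd => //; rewrite adj_sym. Qed.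

Lemma pred2C (s t : S) : pred2 s t =1 pred2 t s.
Proof. by move=> x /=; rewrite orbC. Qed.

Lemma pred2_letter (s t : S) i : pred2 s t =1 pred2 (letter s t i) (letter t s i).
Proof. by rewrite /letter; case: odd => x /=; rewrite 1?orbC. Qed.

Lemma inWT_alt s t i : inWT gen (pred2 s t) (alt gen s t i).
Proof.
elim: i => [|i IH] /=; first exact: inWT1.
by apply: inWTM => //; apply/inWT_gen/letter_pair.
Qed.

Lemma inWT_rcons_ind (T : pred S) (P : W -> Prop) : P 1 ->
  (forall x s, T s -> P x -> P (x * gen s)) -> forall x, inWT gen T x -> P x.
Proof.
move=> P1 PM x [w [Tw <-]]; elim/last_ind: w Tw => [|w s IH] //.
by rewrite all_rcons evalw_rcons => /andP[Ts /IH]; exact: PM.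
Qed.

Lemma inWT_alt_form s t x : inWT gen (pred2 s t) x ->
  exists i, x = alt gen s t i \/ x = alt gen t s i.
Proof.
have step a b i r : pred2 a b r ->
  exists j, alt gen a b i * gen r = alt gen a b j \/ alt gen a b i * gen r = alt gen b a j.
  rewrite (pred2_letter a b i) => /orP[]/eqP->; first by exists i.+1; left.
  case: i => [|i]; first by exists 1%N; right.
  by exists i; left; rewrite letterS /= gen_mulK.
move: x; apply: inWT_rcons_ind => [|y r str [i [->|->]]]; first by exists 0%N; left.
  exact: step.
have [|j [->|->]] := step t s i r; first by rewrite pred2C.
  by exists j; right.
by exists j; left.
Qed.

Lemma expg_mul_shift (G : groupType) (x y : G) k :
  x * (y * x) ^+ k = (x * y) ^+ k * x.
Proof.
elim: k => [|k IH]; first by rewrite !expg0 mulg1 mul1g.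
by rewrite expgSr mulgA IH expgSr !mulgA.
Qed.

Lemma inversion_alt s t i p : inversion (alt gen s t i) p -> exists2 k, (k < i)%N &
  p = (gen (letter t s i) * gen (letter s t i)) ^+ k * gen (letter t s i).
Proof.
elim: i p => [|i IH] p /=; first by rewrite inversion1.
rewrite inversionM inversion_gen !letterS; case: eqP => [-> _|_].
  by exists 0%N; rewrite // expg0 mul1g.
rewrite addbF => /IH[k ki /eqP]; rewrite conj_eq gen_inv => /eqP ->.
by exists k.+1; rewrite // mulgA expg_mul_shift expgSr !mulgA.
Qed.

(** Equating the next letter with one of the reflections of [inversion_alt] gives a relation of
    exponent [k + 1 <= i] between the two generators, so [gen_mul_order] applies. *)
Lemma inversion_alt_letter s t i : s != t ->
  inversion (alt gen s t i) (gen (letter s t i)) -> adj s t /\ (m <= i)%N.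
Proof.
move=> st /inversion_alt[k ki].
move=> /(congr1 (fun x => x * gen (letter s t i))); rewrite gen_sq -mulgA -expgSr.
move=> /esym/gen_mul_order[]//; first by rewrite letter_neq // eq_sym.
move=> a_adj /dvdn_leq mk; split; last by apply: leq_trans (mk _) ki.
by move: a_adj; rewrite /letter; case: odd => //; rewrite adj_sym.
Qed.

(** Modulo the shortest representative of its coset, [v] becomes an alternating word in [s] and [t].
    One of the two is the letter that prolongs this word, and it can be a descent only if [s] and
    [t] are adjacent. *)
Lemma descents_adj v s t : s != t ->
  inversion v (gen s) -> inversion v (gen t) -> adj s t.
Proof.
move=> st; have [umin [x Tx ->]] := cmin_spec (pred2 s t) v.
have Ts : inWT gen (pred2 s t) (gen s) by apply: inWT_gen; rewrite /= eqxx.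
have Tt : inWT gen (pred2 s t) (gen t) by apply: inWT_gen; rewrite /= eqxx orbT.
rewrite !(min_in_coset_inversionM umin Tx) //.
case: (inWT_alt_form Tx) => i [->|->] xs xt.
  by have [] // := @inversion_alt_letter s t i st; rewrite /letter; case: odd.
rewrite adj_sym; have [] // := @inversion_alt_letter t s i; first by rewrite eq_sym.
by rewrite /letter; case: odd.
Qed.

Lemma alt_add s t i k : alt gen s t (i + 2 * k) =
  alt gen s t i * (gen (letter s t i) * gen (letter t s i)) ^+ k.
Proof.
elim: k => [|k IH]; first by rewrite muln0 addn0 expg0 mulg1.
rewrite mulnS addnCA /= IH !letterS.
have lE (a b : S) : letter a b (i + 2 * k) = letter a b i.
  by rewrite /letter oddD mul2n odd_double addbF.
by rewrite !lE expgSr !mulgA.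
Qed.

Lemma adj_neq s t : adj s t -> s != t.
Proof. by apply: contraTneq => ->. Qed.

(** Equal elements have positions of equal parity, so they differ by a power of a product of the two
    generators with exponent below [m]. *)
Lemma alt_inj s t i j : adj s t -> (i < 2 * m)%N -> (j < 2 * m)%N ->
  alt gen s t i = alt gen s t j -> i = j.
Proof.
move=> st; wlog ij : i j / (i <= j)%N.
  by move=> H lti ltj e; have [/H|/ltnW/H] := leqP i j; [exact|move/(_ ltj lti (esym e))].
move=> lti ltj e; have := alt_parity e => par.
have [k jk] : exists k, j = (i + 2 * k)%N.
  exists (j - i)./2; rewrite mul2n -[X in (i + X)%N]add0n.
  have <- : odd (j - i) = 0%N :> nat by rewrite oddB // par addbb.
  by rewrite odd_double_half subnKC.
case: k jk => [|k] jk; first by rewrite jk muln0 addn0.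
move: e; rewrite jk alt_add -{1}[alt gen s t i]mulg1 => /mulgI/esym/gen_mul_order.
move=> []; rewrite ?letter_neq ?adj_neq // => _ /dvdn_leq; lia.
Qed.

Lemma alt_period s t : adj s t -> alt gen s t (2 * m) = 1.
Proof. by move=> st; rewrite -[(2 * m)%N]add0n alt_add mul1g gen_braid. Qed.

Lemma inWT_alt_lt s t x : adj s t -> inWT gen (pred2 s t) x ->
  exists2 i, (i < 2 * m)%N & x = alt gen s t i.
Proof.
move=> st; have m0 : (0 < 2 * m)%N by lia.
move: x; apply: inWT_rcons_ind => [|y r str [i lti ->]]; first by exists 0%N.
move: str; rewrite (pred2_letter s t i) => /orP[]/eqP->.
  have [lti'|gei] := ltnP i.+1 (2 * m); first by exists i.+1.
  exists 0%N => //; rewrite -[LHS]/(alt gen s t i.+1).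
  have -> : i.+1 = (2 * m)%N by lia.
  exact: alt_period.
case: i lti => [|i] lti; last first.
  exists i; first by lia.
  by rewrite letterS /= gen_mulK.
(* Going from 1 along the edge [t] runs backwards around the polygon to its last vertex. *)
exists (2 * m).-1; first by lia.
rewrite mul1g -[RHS](gen_mulK _ (letter s t (2 * m).-1)).
rewrite -[alt _ _ _ _ * _]/(alt gen s t (2 * m).-1.+1) prednK // alt_period //.
rewrite mul1g -[letter t s 0]letterS; congr gen.
by rewrite /letter; have -> : odd (2 * m).-1 by lia.
Qed.

(** Each endpoint of the edge is visited once by the boundary walk, at positions [i0] and [j0] of
    opposite parity. Hence exactly one of them is left along the letter [r], and the sum reduces to
    a single 1 or -1. *)
Lemma inc2_unit u s t x r : adj s t -> pred2 s t r -> inWT gen (pred2 s t) x ->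
  Rsqr (inc2 gen m u s t (u * x) r) = 1%Re.
Proof.
move=> st str Tx.
have [i0 lti0 ex] := inWT_alt_lt st Tx.
have [j0 ltj0 exr] := inWT_alt_lt st (inWTM Tx (inWT_gen str)).
have par : odd j0 = ~~ odd i0.
  have [sg [sgM sgg]] := sign_morphism.
  have := congr1 sg exr; rewrite ex sgM sgg !sign_alt // => <-; exact: addbT.
pose ev (i : nat) (c : R) (j : nat) := if j == i then c else R0.
have sumE (i : nat) c : (i < 2 * m)%N -> \big[Rplus/R0]_(j < 2 * m) ev i c j = c.
  move=> lti; rewrite (bigD1 (Ordinal lti)) //= big1 ?Rplus_0_r /ev ?eqxx //.
  by move=> j; rewrite -val_eqE /= => /negPf->.
pose c (i : nat) := if letter s t i == r then R1 else R0.
have -> : inc2 gen m u s t (u * x) r =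
    \big[Rplus/R0]_(j < 2 * m) Rplus (ev i0 (c i0) j) (ev j0 (Ropp (c j0)) j).
  apply: eq_bigr => j _; rewrite -mulgA !(can_eq (mulKg u)) exr ex.
  have altE (i : nat) : (i < 2 * m)%N -> (alt gen s t j == alt gen s t i) = (j == i :> nat).
    by move=> lti; apply/eqP/eqP => [/(alt_inj st)->|->].
  rewrite !altE // /ev /c.
  case: (nat_of_ord j =P i0) => [<-|_]; case: (nat_of_ord j =P j0) => [<-|_];
    by case: ifP => _; lra.
rewrite big_split /= !sumE // /c /letter par.
have /negPf ts : t != s by rewrite eq_sym adj_neq.
have /negPf st' := adj_neq st.
by case: odd => /=; move: str => /orP[]/eqP->; rewrite ?eqxx ?ts ?st' /Rsqr; lra.
Qed.

(** * The forest of oriented 2-cells *)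

Hypotheses (adj_tri : forall a b c, adj a b -> adj b c -> adj a c -> False)
  (deg_le : forall s, (#|adj s| <= m)%N).

(* A 2-cell together with one of the two edges at its shortest vertex: the edge
   [(c.1.1, c.1.2)] of the cell [c.1.1 W_{c.1.2, c.2}]. *)
Definition oriented_cell (c : W * S * S) : Prop :=
  adj c.1.2 c.2 /\ min_in_coset gen (pred2 c.1.2 c.2) c.1.1.

(** An alternating word of length below [m] is never shortened by its next letter, so the walk from
    the shortest vertex climbs for [m] steps. *)
Lemma oriented_cell_ascent u a b i : oriented_cell (u, a, b) -> (i < m)%N ->
  ~~ inversion (u * alt gen a b i) (gen (letter a b i)).
Proof.
move=> [/= ab umin] im; rewrite (min_in_coset_inversionM umin).
- apply/negP => /(inversion_alt_letter (adj_neq ab))[_]; lia.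
- exact: inWT_alt.
- exact/inWT_gen/letter_pair.
Qed.

Lemma oriented_cell_descent u a b i : oriented_cell (u, a, b) -> (0 < i < m)%N ->
  inversion (u * alt gen a b i) (gen (letter b a i)).
Proof.
case: i => // i uc /= im; rewrite letterS mulgA inversionM inversion_gen eqxx mulgK.
by rewrite (negPf (oriented_cell_ascent uc _)) //; lia.
Qed.

Lemma len_alt u a b i : oriented_cell (u, a, b) -> (i <= m)%N ->
  (len gen u + i <= len gen (u * alt gen a b i))%N.
Proof.
move=> uc; elim: i => [|i IH] im; first by rewrite mulg1 addn0.
rewrite addnS /= mulgA; apply: leq_ltn_trans (IH (ltnW im)) _.
exact/len_not_inversion/oriented_cell_ascent.
Qed.

(** The index [(i, t)] picks the edge leaving the [i]-th vertex of the walk [u], [u a], [u a b], ...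
    and another cell around it. The shared edge is stored first, so the walk of the child starts
    along it. *)
Definition child (c : W * S * S) (y : nat * S) : W * S * S :=
  (c.1.1 * alt gen c.1.2 c.2 y.1, letter c.1.2 c.2 y.1, y.2).

(** The excluded letter [letter b a i] would give back the parent cell. *)
Definition other_neighbours a b i : {pred S} :=
  [pred t | adj (letter a b i) t & t != letter b a i].

Definition child_index (c : W * S * S) : seq (nat * S) :=
  [seq (i, t) | i <- iota 1 m.-1, t <- enum (other_neighbours c.1.2 c.2 i)].

Lemma child_indexP c i t : (i, t) \in child_index c ->
  [/\ (0 < i < m)%N, adj (letter c.1.2 c.2 i) t & t != letter c.2 c.1.2 i].
Proof.
move=> /allpairsPdep[i' [t' [+ + [-> ->]]]].
by rewrite mem_iota mem_enum inE => im /andP[? ?]; split=> //; lia.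
Qed.

Lemma child_index_uniq c : uniq (child_index c).
Proof.
apply: allpairs_uniq_dep; first exact: iota_uniq.
  by move=> i _; exact: enum_uniq.
by move=> [i t] [j r] _ _ /= [-> ->].
Qed.

Lemma child_oriented c y : oriented_cell c -> y \in child_index c ->
  oriented_cell (child c y).
Proof.
move: c y => [[u a] b] [i t] uc /child_indexP[/= im rt tb]; split=> //=.
apply: min_in_coset_descents => s /orP[]/eqP->.
  by apply: oriented_cell_ascent uc _; lia.
apply/negP => vt; apply: (@adj_tri (letter a b i) t (letter b a i)) => //.
  by apply: descents_adj vt (oriented_cell_descent uc im).
by apply: letter_adj; case: uc.
Qed.

Lemma len_child c y : oriented_cell c -> y \in child_index c ->
  (len gen c.1.1 < len gen (child c y).1.1)%N.
Proof.
move: c y => [[u a] b] [i t] uc /child_indexP[/= im _ _].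
by apply: leq_trans (len_alt uc _); lia.
Qed.

(* The edge [(v, r)] determines the parent cell [v W_{r, r'}]: [r'] is the
   only descent of [v] adjacent to [r], because there are no 3-cycles. *)
Lemma child_inj c c' y y' : oriented_cell c -> oriented_cell c' ->
  y \in child_index c -> y' \in child_index c' ->
  child c y = child c' y' -> c = c' /\ y = y'.
Proof.
move: c c' y y' => [[u a] b] [[u' a'] b'] [i t] [i' t'] uc uc'.
move=> /child_indexP[/= im _ _] /child_indexP[/= im' _ _] [/= ev er ->].
have [ab umin] := uc; have [ab' umin'] := uc'; rewrite /= in ab umin ab' umin'.
have er' : letter b a i = letter b' a' i'.
  apply/eqP; apply: contraT => rr'; exfalso.
  apply: (adj_tri (letter_adj i ab) _ (_ : adj _ (letter b' a' i'))).
    apply: descents_adj rr' (oriented_cell_descent uc im) _.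
    by rewrite ev; exact: oriented_cell_descent uc' im'.
  by rewrite er; exact: letter_adj.
have TT' : pred2 a' b' =1 pred2 a b.
  by move=> x; rewrite (pred2_letter a' b' i') (pred2_letter a b i) er er'.
have uu' : u = u'.
  rewrite -(cmin_eq umin (inWT_alt a b i)) ev cmin_eq //; last exact/(inWT_eq TT')/inWT_alt.
  exact: min_in_coset_eq umin'.
move: ev; rewrite uu' => /mulgI ev.
have ab_eq : a = a' /\ b = b'.
  move: er er'; rewrite /letter (alt_parity ev); case: odd => -> ->; by [].
case: ab_eq ev => -> -> /(alt_inj ab') -> //; lia.
Qed.

Definition offspring (l : seq (W * S * S)) : seq (W * S * S) :=
  [seq child c y | c <- l, y <- child_index c].

Lemma offspring_uniq l : (forall c, c \in l -> oriented_cell c) -> uniq l ->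
  uniq (offspring l).
Proof.
move=> lc ul; apply: allpairs_uniq_dep => // [c _|]; first exact: child_index_uniq.
move=> _ _ /allpairsPdep[c [y [cl yc ->]]] /allpairsPdep[c' [y' [cl' yc' ->]]] /=.
by move=> /(child_inj (lc _ cl) (lc _ cl') yc yc')[-> ->].
Qed.

Section Energy.
Variables (q : S -> R) (g : chain2 S W).
Hypotheses (q_gt0 : forall s, (0 < q s)%Re) (q_le1 : forall s, (q s <= 1)%Re).

Lemma qW_bounds u : (0 < qW gen q u <= 1)%Re.
Proof.
have [[w [szw wu]] _] := len_spec u.
have : exists w, evalw gen w = u /\ size w = len gen u /\
    qW gen q u = prodR (map q w).
  apply: (epsilon_spec (inhabits R1) (fun x =>
    exists w, evalw gen w = u /\ size w = len gen u /\ x = prodR (map q w))).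
  by exists (prodR (map q w)), w.
move=> [v [_ [_ ->]]].
elim: v => [|s v IH] /=; first lra.
have := q_gt0 s; have := q_le1 s => *; split; first by apply: Rmult_lt_0_compat; lra.
by rewrite -(Rmult_1_r 1); apply: Rmult_le_compat; lra.
Qed.

(* The value of [c.1.1 W_{c.1.2, c.2}] in the unweighted cycle attached to [g]. *)
Definition cell_value (c : W * S * S) : R :=
  Rmult (qW gen q c.1.1) (if (enum_rank c.1.2 < enum_rank c.2)%N
    then g c.1.1 c.1.2 c.2 else g c.1.1 c.2 c.1.2).

Definition energy (l : seq (W * S * S)) : R :=
  \big[Rplus/R0]_(c <- l) Rsqr (cell_value c).

Lemma cell_valueC u a b : a != b -> cell_value (u, a, b) = cell_value (u, b, a).
Proof.
move=> ab; rewrite /cell_value /=.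
have : enum_rank a != enum_rank b by rewrite (inj_eq enum_rank_inj).
by rewrite -val_eqE neq_ltn => /orP[] lt; rewrite lt ltnNge ltnW.
Qed.

Lemma bd2_term_sqr u x r t : adj r t -> min_in_coset gen (pred2 r t) u ->
  inWT gen (pred2 r t) x ->
  Rsqr (let s1 := if (enum_rank r < enum_rank t)%N then r else t in
        let t1 := if (enum_rank r < enum_rank t)%N then t else r in
        let c := cmin gen (pred2 r t) (u * x) in
        Rmult (Rmult (inc2 gen m c s1 t1 (u * x) r) (qW gen q c)) (g c s1 t1)) =
  Rsqr (cell_value (u, r, t)).
Proof.
move=> rt umin Tx; rewrite /= cmin_eq // /cell_value /= Rmult_assoc Rsqr_mult.
case: ifP => _; rewrite inc2_unit ?Rmult_1_l //= ?eqxx ?orbT //.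
  by rewrite adj_sym.
exact: inWT_eq (@pred2C r t) Tx.
Qed.

Hypothesis cycle : forall v r, is_cell1 gen v r -> bd2 gen adj m q g v r = R0.

Lemma top_edge_energy u a b i : oriented_cell (u, a, b) -> (0 < i < m)%N ->
  (Rsqr (cell_value (u, a, b)) <= INR m.-1 *
    \big[Rplus/R0]_(t <- enum (other_neighbours a b i))
      Rsqr (cell_value (child (u, a, b) (i, t))))%Re.
Proof.
move=> uc im; have [/= ab umin] := uc.
set v := u * alt gen a b i; set r := letter a b i; set r' := letter b a i.
have rr' : adj r r' by exact: letter_adj.
have vr : is_cell1 gen v r.
  by apply: min_in_coset_descents => _ /eqP ->; apply: oriented_cell_ascent uc _; lia.
have := cycle vr; rewrite /bd2.
have q0 : Rinv (qW gen q v) <> R0 by apply: Rinv_neq_0_compat; have := qW_bounds v; lra.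
case/Rmult_integral => // ; rewrite (bigD1 r') //=.
set X := (X in Rplus X _); set Y := (X in Rplus _ X) => XY.
have XE : Rsqr X = Rsqr (cell_value (u, a, b)).
  rewrite [LHS]bd2_term_sqr //; last first.
  - exact/(inWT_eq (pred2_letter a b i))/inWT_alt.
  - exact: min_in_coset_eq (pred2_letter a b i) umin.
  rewrite /r /r' /letter; case: odd => //; rewrite cell_valueC // eq_sym.
  exact: adj_neq.
have {}XY : X = Ropp Y by lra.
rewrite -XE XY -Rsqr_neg.
rewrite /Y (eq_bigl (fun t => t \in other_neighbours a b i)); last first.
  by move=> t; rewrite inE.
rewrite -big_enum /=.
apply: Rle_trans (sumR_sqr_le _ _) _; apply: Rmult_le_compat.
- exact: pos_INR.
- by apply: sumR_ge0 => t; exact: Rle_0_sqr.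
- apply/le_INR/leP; rewrite -cardE -ltnS prednK; last by lia.
  have -> : #|other_neighbours a b i| = #|[predD1 adj r & r']|.
    by apply: eq_card => t; rewrite !inE andbC.
  by have := deg_le r; rewrite (cardD1 r') [r' \in _]rr' add1n.
apply: sumR_le => t; rewrite mem_enum inE => /andP[/= rt tr'].
apply: Req_le; rewrite -[v in LHS]mulg1 bd2_term_sqr //; last exact: inWT1.
have ic : (i, t) \in child_index (u, a, b).
  apply: allpairs_f_dep; first by rewrite mem_iota; lia.
  by rewrite mem_enum inE rt.
by case: (child_oriented uc ic).
Qed.

Lemma energy_child c : oriented_cell c ->
  (Rsqr (cell_value c) <= energy [seq child c y | y <- child_index c])%Re.
Proof.
case: c => [[u a] b] uc; rewrite /energy big_map big_allpairs_dep.
have m0 : (0 < INR m.-1)%Re by apply/lt_0_INR/ltP; lia.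
apply: (Rmult_le_reg_l _ _ _ m0).
rewrite -{1}(size_iota 1 m.-1) -sumR_const sumR_distrr.
apply: sumR_le => i; rewrite mem_iota => im; apply: top_edge_energy => //; lia.
Qed.

Lemma energy_offspring l : (forall c, c \in l -> oriented_cell c) ->
  (energy l <= energy (offspring l))%Re.
Proof.
move=> lc; rewrite /energy big_allpairs_dep; apply: sumR_le => c /lc /energy_child.
by rewrite /energy big_map.
Qed.

Lemma generation c k : oriented_cell c -> exists l : seq (W * S * S),
  [/\ uniq l, forall d, d \in l -> oriented_cell d /\ (k <= len gen d.1.1)%N &
      (Rsqr (cell_value c) <= energy l)%Re].
Proof.
move=> cc; elim: k => [|k [l [ul lc el]]].
  exists [:: c]; split=> // [d|]; first by rewrite inE => /eqP ->.
  by rewrite /energy big_seq1; lra.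
have lc1 d : d \in l -> oriented_cell d by case/lc.
exists (offspring l); split; first exact: offspring_uniq.
  move=> _ /allpairsPdep[d [y [dl yd ->]]]; have [dc kd] := lc _ dl.
  by split; [exact: child_oriented|apply: leq_ltn_trans kd (len_child dc yd)].
by apply: Rle_trans el _; exact: energy_offspring.
Qed.

Lemma energy_unbounded c n : oriented_cell c -> exists l : seq (W * S * S),
  [/\ uniq l, forall d, d \in l -> oriented_cell d &
      (INR n * Rsqr (cell_value c) <= energy l)%Re].
Proof.
move=> cc; elim: n => [|n [l [ul lc el]]].
  by exists [::]; split=> //; rewrite /energy big_nil /=; lra.
pose k := (\max_(d <- l) len gen d.1.1).+1.
have [l' [ul' lc' el']] := generation k cc.
exists (l ++ l'); split.
- rewrite cat_uniq ul ul' andbT; apply/hasPn => d /lc'[_ kd].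
  apply/negP => dl; move: kd; rewrite /k ltnNge => /negP; apply.
  exact: (leq_bigmax_seq (F := fun c => len gen c.1.1) d).
- by move=> d; rewrite mem_cat => /orP[/lc|/lc'[]].
- by rewrite /energy big_cat S_INR; move: el el'; rewrite /energy /=; lra.
Qed.

Lemma energy_bounded : sq_summable2 gen adj q g -> exists B,
  forall l, uniq l -> (forall c, c \in l -> oriented_cell c) -> (energy l <= B)%Re.
Proof.
move=> [B Bsum]; exists (B + B)%Re => l ul lc.
have sorted_le l' : uniq l' -> (forall c, c \in l' -> oriented_cell c) ->
    (forall c, c \in l' -> (enum_rank c.1.2 < enum_rank c.2)%N) -> (energy l' <= B)%Re.
  move=> ul' lc' srt; apply: Rle_trans (Bsum l' ul' _); last first.
    by move=> c cl; have [] := lc' c cl; split=> //; split=> //; exact: srt.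
  apply: sumR_le => c /srt lt; rewrite /cell_value lt Rsqr_mult -/(Rsqr _).
  have := qW_bounds c.1.1; have := Rle_0_sqr (g c.1.1 c.1.2 c.2).
  move: (qW _ _ _) (Rsqr (g _ _ _)) => Q G G0 [Q0 Q1]; rewrite /Rsqr Rmult_comm.
  by apply: Rmult_le_compat_l => //; nra.
pose P (c : W * S * S) := (enum_rank c.1.2 < enum_rank c.2)%N.
pose swap (c : W * S * S) : W * S * S := (c.1.1, c.2, c.1.2).
have swapK : cancel swap swap by move=> [[]].
have swap_inj := can_inj swapK.
pose l1 := [seq c <- l | P c]; pose l2 := map swap [seq c <- l | ~~ P c].
have -> : energy l = (energy l1 + energy l2)%Re.
  rewrite /energy (bigID P) /= big_filter big_map big_filter; congr Rplus.
  rewrite big_seq_cond [RHS]big_seq_cond; apply: eq_bigr => -[[u a] b] /andP[/lc[/= ab _] _].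
  by rewrite cell_valueC ?adj_neq.
apply: Rplus_le_compat; apply: sorted_le.
- exact: filter_uniq.
- by move=> c; rewrite mem_filter => /andP[_ /lc].
- by move=> c; rewrite mem_filter => /andP[].
- by rewrite map_inj_uniq // filter_uniq.
- move=> _ /mapP[[[u a] b] + ->]; rewrite mem_filter => /andP[_ /lc[/= ab umin]].
  by split; rewrite /= ?[adj b a]adj_sym //; apply: min_in_coset_eq umin; exact: pred2C.
- move=> _ /mapP[[[u a] b] + ->]; rewrite mem_filter /P /= => /andP[nlt /lc[/= ab _]].
  by rewrite ltn_neqAle leqNgt nlt val_eqE (inj_eq enum_rank_inj) eq_sym adj_neq.
Qed.

Lemma cycle_eq0 u s t : sq_summable2 gen adj q g -> is_cell2 gen adj u s t ->
  g u s t = R0.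
Proof.
move=> /energy_bounded[B Bl] [st [lt umin]].
have cc : oriented_cell (u, s, t) by [].
have v0 : Rsqr (cell_value (u, s, t)) = R0.
  have := Rle_0_sqr (cell_value (u, s, t)); set e := Rsqr _ => e0.
  case: (Rle_lt_or_eq_dec _ _ e0) => // e_gt0.
  have [n Bn] := INR_unbounded (B / e).
  have [l [ul lc]] := energy_unbounded n cc; rewrite -/e => le.
  have := Bl l ul lc.
  have := Rmult_lt_compat_r _ _ _ e_gt0 Bn.
  have -> : (B / e * e = B)%Re by field; lra.
  lra.
move: (Rsqr_0_uniq _ v0); rewrite /cell_value /= lt.
by case/Rmult_integral => //; have := qW_bounds u; lra.
Qed.

End Energy.
End CoxeterGroup.

Theorem theorem7p7 (S : finType) (adj : rel S) (m : nat)
  (W : groupType) (gen : S -> W) (q : S -> R) :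
  (* nerve L: simple graph (adj) with no 3-cycles, all edges labelled m *)
  (forall s, ~~ adj s s) ->
  (forall s t, adj s t = adj t s) ->
  (forall a b c, adj a b -> adj b c -> adj a c -> False) ->
  (2 <= m)%N ->
  is_coxeter gen adj m ->
  (* m is a multiple of lcm_{s in S} deg(s) *)
  (\big[lcmn/1%N]_(s : S) #|adj s| %| m)%N ->
  (* multiparameter q <= 1 *)
  (forall s, Rlt R0 (q s)) ->
  (forall s t (w : W), gen t = w^-1 * (gen s * w) -> q s = q t) ->
  (forall s, Rle (q s) R1) ->
  L2H2_vanishes gen adj m q.
Proof.
move=> adj_irr adj_sym adj_tri m_gt1 cox lcm_m q_gt0 _ q_le1 g g_sum cyc u s t.
have deg_le r : (#|adj r| <= m)%N.
  by apply: dvdn_leq; [lia|apply: dvdn_trans lcm_m; exact: biglcmn_sup].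
exact: (cycle_eq0 adj_irr adj_sym m_gt1 cox adj_tri deg_le q_gt0 q_le1 cyc).
Qed.
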